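(* Let $\delta>0$ be fixed. For each $n$ let $X=X(n)$ be a balanced random covering variable for an $n$-set $V=V(n)$ which has pairwise negative correlation, and suppose $\mathbb{P}(x\in X)=c$ for all $x\in V$, where $0<c=c(n)\le1-\delta$. Then whp $T(\mathbf{X})=(1+o(1))\frac{\log n}{-\log(1-c)}$.
   Context: A random covering variable (random coupon) for a finite set $V$ is a random variable $X$ with values in the power set of $V$. It is balanced if $\mathbb{P}(v\in X)=\mathbb{P}(v'\in X)$ for all $v,v'\in V$. Pairwise negative correlation means $\mathbb{P}(x,y\notin X)\le\mathbb{P}(x\notin X)\,\mathbb{P}(y\notin X)$ for all $x\ne y$ in $V$. The $X$-coupon collector receives i.i.d. coupons $\mathbf{X}=(X_1,X_2,\dots)$ with $X_i\sim X$; $C_t=\bigcup_{i\le t}X_i$; the covering time is $T(\mathbf{X})=\inf\{t\in\mathbb{Z}_{\ge0}:C_t=V\}$. ''$T=(1+o(1))f(n)$ whp'' means $T/f(n)\to1$ in probability as $n\to\infty$. *)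

(* Defs.v *)
From HB Require Import structures.
From mathcomp Require Import all_boot all_order all_algebra finmap.
From mathcomp Require Import all_classical all_reals all_analysis.

Set Implicit Arguments.
Unset Strict Implicit.
Unset Printing Implicit Defensive.

Import Order.TTheory GRing.Theory Num.Theory.
Import numFieldNormedType.Exports.

Local Open Scope classical_set_scope.
Local Open Scope ring_scope.

(* The power set of the finite set V, with the discrete sigma-algebra. *)
Definition coupon (V : finType) : Type := {set V}.

HB.instance Definition _ (V : finType) := Finite.on (coupon V).
HB.instance Definition _ (V : finType) := isPointed.Build (coupon V) finset.set0.
HB.instance Definition _ (V : finType) :=
  @isMeasurable.Build default_measure_display (coupon V)
    (@discrete_measurable (coupon V)) (@discrete_measurable0 (coupon V))
    (@discrete_measurableC (coupon V)) (@discrete_measurableU (coupon V)).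

Section RandomCoupon.
Context (R : realType) (V : finType) (d : measure_display)
  (Omega : measurableType d) (P : probability Omega R).
Local Open Scope ereal_scope.

Definition balanced (X : {RV P >-> coupon V}) : Prop :=
  forall v v' : V,
    P [set w | v \in (X w : {set V})] = P [set w | v' \in (X w : {set V})].

Definition pairwise_negative_correlation (X : {RV P >-> coupon V}) : Prop :=
  forall x y : V, x != y ->
    P [set w | x \notin (X w : {set V}) /\ y \notin (X w : {set V})] <=
    P [set w | x \notin (X w : {set V})] * P [set w | y \notin (X w : {set V})].

Definition mutually_independent (Xs : nat -> {RV P >-> coupon V}) : Prop :=
  forall (J : {fset nat}) (A : nat -> set (coupon V)),
    P (\bigcap_(j in [set` J]) (Xs j @^-1` A j)) =
    \prod_(j <- J) P (Xs j @^-1` A j).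

(* Coupons are numbered from 0: Xs i is the (i+1)-st coupon collected. *)
Definition collected (Xs : nat -> {RV P >-> coupon V}) (t : nat) (w : Omega) :
    {set V} :=
  (\bigcup_(i < t) (Xs i w : {set V}))%SET.

(* +oo when V is never covered, as ereal_inf set0 = +oo. *)
Definition covering_time (Xs : nat -> {RV P >-> coupon V}) (w : Omega) :
    \bar R :=
  ereal_inf [set t%:R%:E | t in [set t : nat | collected Xs t w = [set: V]%SET]].

End RandomCoupon.

Section Iid.
Context (R : realType) (V : finType) (d d' : measure_display)
  (Omega : measurableType d) (Omega' : measurableType d')
  (P : probability Omega R) (Q : probability Omega' R).

Definition iid_copies (X : {RV P >-> coupon V})
    (Xs : nat -> {RV Q >-> coupon V}) : Prop :=
  mutually_independent Xs /\
  forall (i : nat) (A : set (coupon V)),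
    distribution Q (Xs i) A = distribution P X A.

End Iid.

(* The n-th variable lives on its own probability space; infinite values are
   allowed and count as deviations from the limit. *)
Definition cvg_in_probability (R : realType) (d : nat -> measure_display)
    (Omega : forall n, measurableType (d n))
    (P : forall n, probability (Omega n) R)
    (Y : forall n, Omega n -> \bar R) (l : R) : Prop :=
  forall eps : R, 0 < eps ->
    (P n [set w | (eps%:E < `|Y n w - l%:E|)%E] @[n --> \oo] --> 0%E).

(* Main.v *)
(* Put q = 1 - c and L = log n / - log q, and let N_t be the number of elements
   missed by the first t coupons; each element is missed with probability q^t.
   For t just above (1 + eps) L - 1, the union bound gives
   P(N_t > 0) <= n q^t <= n^-eps / q, and q >= delta.  For t <= (1 - eps) L,
   negative correlation makes Var N_t <= E N_t = n q^t >= n^eps, so Chebyshev's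
   inequality gives P(N_t = 0) <= n^-eps.  Both moment computations are finite
   sums against the law of the random set collected so far. *)
Require Import Defs.
From HB Require Import structures.
From mathcomp Require Import all_boot all_order all_algebra finmap.
From mathcomp Require Import all_classical all_reals all_analysis.
From mathcomp Require Import ring lra.

Import Order.TTheory GRing.Theory Num.Theory.
Import numFieldNormedType.Exports.

Local Open Scope classical_set_scope.
Local Open Scope ring_scope.

(** * Moments of the number of missed elements, for a weight on subsets *)

Section FiniteMoments.
Context {R : realFieldType} {V : finType}.
Context (p : {set V} -> R).
Context (p_ge0 : forall S, 0 <= p S).

Lemma sum_card_setC :
  \sum_S p S * #|~: S|%:R = \sum_x \sum_(S : {set V} | x \notin S) p S.
Proof.
under [RHS]eq_bigr do rewrite big_mkcond.
rewrite exchange_big; apply: eq_bigr => S _ /=.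
rewrite -big_mkcond mulr_natr -sumr_const.
by apply: eq_bigl => x; rewrite !inE.
Qed.

(** Write [#|~: S|] as a sum of indicators of missed elements; squaring it produces ordered pairs,
    the diagonal included. *)
Lemma sum_card_setC_sqr :
  \sum_S p S * #|~: S|%:R ^+ 2 =
  \sum_x \sum_y \sum_(S : {set V} | (x \notin S) && (y \notin S)) p S.
Proof.
have cE (S : {set V}) : #|~: S|%:R = \sum_x (x \notin S)%:R :> R.
  rewrite -sum1_card natr_sum big_mkcond; apply: eq_bigr => x _.
  by rewrite inE; case: (x \in S).
transitivity (\sum_(S : {set V}) \sum_x \sum_y
    p S * ((x \notin S)%:R * (y \notin S)%:R)).
  apply: eq_bigr => S _; rewrite cE expr2 mulr_suml mulr_sumr.
  by apply: eq_bigr => x _; rewrite !mulr_sumr.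
rewrite exchange_big; apply: eq_bigr => x _ /=.
rewrite exchange_big; apply: eq_bigr => y _ /=.
rewrite [RHS]big_mkcond; apply: eq_bigr => S _.
by case: (x \notin S); case: (y \notin S); rewrite /= ?(mulr1, mulr0, mul0r).
Qed.

(** Markov's inequality: a set other than [V] misses at least one element, so [#|~: S|] dominates
    the indicator of [S != V]. *)
Lemma sum_neqT_le (a : R) :
  (forall x, \sum_(S : {set V} | x \notin S) p S <= a) ->
  \sum_(S | S != [set: V]%SET) p S <= #|V|%:R * a.
Proof.
move=> ha; apply: (@le_trans _ _ (\sum_S p S * #|~: S|%:R)).
  rewrite big_mkcond; apply: ler_sum => S _.
  case: ifPn => [SnT|_]; last by rewrite mulr_ge0.
  rewrite ler_peMr// ler1n card_gt0; apply: contraNneq SnT => SC0.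
  by rewrite -[S]finset.setCK SC0 finset.setC0.
rewrite sum_card_setC mulr_natl -sumr_const; exact: ler_sum.
Qed.

(** Chebyshev's inequality: at [S = V] the count is 0, a full mean [n * a] below its expectation,
    while the variance is at most [n * a]. *)
Lemma weight_setT_le (a : R) : 0 < #|V|%:R * a -> \sum_S p S = 1 ->
  (forall x, \sum_(S : {set V} | x \notin S) p S = a) ->
  (forall x y, x != y ->
    \sum_(S : {set V} | (x \notin S) && (y \notin S)) p S <= a ^+ 2) ->
  p [set: V]%SET <= (#|V|%:R * a)^-1.
Proof.
set n := #|V|%:R => na0 p1 pa paa.
have M1 : \sum_S p S * #|~: S|%:R = n * a.
  by rewrite sum_card_setC (eq_bigr _ (fun x _ => pa x)) sumr_const mulr_natl.
have M2 : \sum_S p S * #|~: S|%:R ^+ 2 <= n * a + (n * a) ^+ 2.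
  rewrite sum_card_setC_sqr.
  apply: (@le_trans _ _ (\sum_(x : V) (a + n * a ^+ 2))).
    (* The diagonal term is [a]; each other [y] gives at most [a ^+ 2], and one spare [a ^+ 2] pads
       these to [n] terms. *)
    apply: ler_sum => x _; rewrite (bigD1 x)//=.
    under eq_bigl do rewrite andbb.
    rewrite pa lerD2l mulr_natl -sumr_const.
    rewrite [leRHS](bigD1 x)//= ler_wpDl ?sqr_ge0//.
    by apply: ler_sum => y yx; rewrite paa// eq_sym.
  by rewrite sumr_const -mulr_natl -/n mulrDr exprMn expr2 mulrA lexx.
have : p [set: V]%SET * (n * a) ^+ 2 <= n * a.
  (* Only the term [S = V] of the variance is kept. *)
  apply: (@le_trans _ _ (\sum_S p S * (#|~: S|%:R - n * a) ^+ 2)).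
    rewrite (bigD1 [set: V]%SET)//= finset.setCT cards0 sub0r sqrrN lerDl.
    by apply: sumr_ge0 => S _; rewrite mulr_ge0// sqr_ge0.
  have -> : \sum_S p S * (#|~: S|%:R - n * a) ^+ 2 =
      \sum_S p S * #|~: S|%:R ^+ 2 - (n * a) ^+ 2.
    transitivity (\sum_S (p S * #|~: S|%:R ^+ 2
        + (- (2 * (n * a)) * (p S * #|~: S|%:R) + (n * a) ^+ 2 * p S))).
      by apply: eq_bigr => S _; ring.
    rewrite !big_split/= -!mulr_sumr M1 p1; ring.
  lra.
by rewrite -ler_pdivlMr ?exprn_gt0// expr2 invfM mulrA divff ?mul1r// gt_eqF.
Qed.

End FiniteMoments.

(** * From probabilities of a random set to finite sums over its law *)

Section RandomSet.
Context {R : realType} {V : finType} {d : measure_display}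
  {Omega : measurableType d} (Q : probability Omega R) (f : Omega -> {set V}).
Context (mf : forall S, measurable [set w | f w = S]).

Lemma measurable_finpred (A : pred {set V}) : measurable [set w | A (f w)].
Proof.
have -> : [set w | A (f w)] = \bigcup_(S in [set S | A S]) [set w | f w = S].
  by apply/seteqP; split=> [w Aw|w [S AS /= ->]]; first exists (f w).
by apply: fin_bigcup_measurable => // S _.
Qed.

(** The event is a finite disjoint union of fibres of [f]. Their probabilities are the weights to
    which the moment bounds are applied. *)
Lemma prob_sum (A : pred {set V}) :
  Q [set w | A (f w)] = (\sum_(S | A S) fine (Q [set w | f w = S]))%:E.
Proof.
have -> : [set w | A (f w)] = \bigcup_(S in [set` A]) [set w | f w = S].
  by apply/seteqP; split=> [w Aw|w [S AS /= ->]]; first exists (f w).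
rewrite measure_fin_bigcup//; last by move=> S S' _ _ [w [/= <- <-]].
rewrite -(@bigfs _ _ _ _ (index_enum _)) ?index_enum_uniq//; last first.
  by move=> S _; rewrite mem_index_enum.
by rewrite -sumEFin; apply: eq_bigr => S _; rewrite fineK// fin_num_measure.
Qed.

Lemma prob_neqT_le (a : R) :
  (forall x, Q [set w | x \notin f w] <= a%:E)%E ->
  (Q [set w | f w != [set: V]%SET] <= (#|V|%:R * a)%:E)%E.
Proof.
move=> ha; rewrite (prob_sum (fun S => S != [set: V]%SET)) lee_fin.
apply: sum_neqT_le => [S|x]; first by rewrite fine_ge0.
by have := ha x; rewrite (prob_sum (fun S => x \notin S)).
Qed.

Lemma prob_eqT_le (a : R) : 0 < #|V|%:R * a ->
  (forall x, Q [set w | x \notin f w] = a%:E)%E ->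
  (forall x y, x != y ->
    Q [set w | (x \notin f w) && (y \notin f w)] <= (a ^+ 2)%:E)%E ->
  (Q [set w | f w = [set: V]%SET] <= ((#|V|%:R * a)^-1)%:E)%E.
Proof.
move=> na0 ha haa; rewrite -[leLHS]fineK ?fin_num_measure// lee_fin.
apply: (@weight_setT_le _ _ (fun S => fine (Q [set w | f w = S]))) => //.
- by move=> S; rewrite fine_ge0.
- apply: EFin_inj; rewrite -(prob_sum xpredT).
  by rewrite -[RHS](probability_setT Q); congr (Q _); apply/seteqP; split.
- by move=> x; apply: EFin_inj; rewrite -(prob_sum (fun S => x \notin S)) ha.
- move=> x y xy; rewrite -lee_fin.
  by rewrite -(prob_sum (fun S => (x \notin S) && (y \notin S))) haa.
Qed.

End RandomSet.

(** * The collected set and the events defined by the covering time *)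

Section Collected.
Context {R : realType} {V : finType} {d : measure_display}
  {Omega : measurableType d} {Q : probability Omega R}
  (Xs : nat -> {RV Q >-> coupon V}).

Lemma collectedS t w :
  collected Xs t.+1 w = (collected Xs t w :|: (Xs t w : {set V}))%SET.
Proof. by rewrite /collected big_ord_recr. Qed.

Lemma notin_collected t w x :
  x \notin collected Xs t w <-> forall i, (i < t)%N -> x \notin (Xs i w : {set V}).
Proof.
elim: t => [|t IH]; first by rewrite /collected big_ord0 inE.
rewrite collectedS inE negb_or; split=> [/andP[xt xXt] i|H].
  by rewrite ltnS leq_eqVlt => /predU1P[->//|]; move: i; apply/IH.
by rewrite H// andbT; apply/IH => i it; apply: H; rewrite ltnW.
Qed.

Lemma collected_covered t t' w : (t <= t')%N ->
  collected Xs t w = [set: V]%SET -> collected Xs t' w = [set: V]%SET.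
Proof.
move=> tt' tV; apply/setP => x; rewrite inE; apply/negPn/negP => /notin_collected xt'.
have : x \notin collected Xs t w.
  by apply/notin_collected => i it; apply: xt'; exact: leq_trans tt'.
by rewrite tV inE.
Qed.

Lemma measurable_collected t S : measurable [set w | collected Xs t w = S].
Proof.
elim: t S => [|t IH] S.
  rewrite /collected; under eq_set do rewrite big_ord0.
  have [->|S0] := eqVneq S finset.set0.
    by rewrite (_ : [set _ | _] = setT)//; apply/seteqP; split.
  rewrite (_ : [set _ | _] = set0)//; apply/seteqP; split=> // w /= S0'.
  by rewrite -S0' eqxx in S0.
(* Split over the finitely many pairs of values of the earlier set and the new coupon. *)
have -> : [set w | collected Xs t.+1 w = S] =
    \bigcup_(A in [set A : {set V} * {set V} | (A.1 :|: A.2)%SET = S])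
      ([set w | collected Xs t w = A.1] `&` Xs t @^-1` [set A.2 : coupon V]).
  apply/seteqP; split=> [w /= wS|w [[A B] /= AB [wA wB]]].
    exists (collected Xs t w, Xs t w : {set V}) => //=.
    by rewrite -collectedS.
  by rewrite collectedS wA wB.
apply: fin_bigcup_measurable => // A _; apply: measurableI; first exact: IH.
by apply: measurable_funPTI.
Qed.

Lemma covering_time_lt w (s : \bar R) : (covering_time Xs w < s)%E <->
  exists2 t, collected Xs t w = [set: V]%SET & (t%:R%:E < s)%E.
Proof.
split=> [/ereal_inf_ltP[_ [t tV <-] ts]|[t tV ts]]; first by exists t.
by apply/ereal_inf_ltP; exists t%:R%:E => //; exists t.
Qed.

(** The collected set only grows and time is integral, so the event is decided at the integer part
    of [s]. *)
Lemma covering_time_gt w (s : R) : 0 <= s ->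
  (s%:E < covering_time Xs w)%E <->
  collected Xs (Num.truncn s) w != [set: V]%SET.
Proof.
move=> s0; split=> [sT|tV].
  apply: contraTneq sT => tV; rewrite -leNgt; apply: ge_ereal_inf.
  exists (Num.truncn s)%:R%:E; first by exists (Num.truncn s).
  by rewrite lee_fin truncn_le.
(* By monotonicity every covering index is at least [truncn s + 1], which exceeds [s]; this also
   bounds the infimum when no index covers. *)
apply: (@lt_le_trans _ _ (Num.truncn s).+1%:R%:E); first by rewrite lte_fin truncnS_gt.
apply: le_ereal_inf_tmp => _ [t tV' <-]; rewrite lee_fin ler_nat ltnNge.
apply: contraNN tV => ts; apply/eqP; exact: collected_covered tV'.
Qed.

Lemma measurable_covering_time_gt (s : R) : 0 <= s ->
  measurable [set w | (s%:E < covering_time Xs w)%E].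
Proof.
move=> s0; rewrite (_ : [set _ | _] =
    [set w | collected Xs (Num.truncn s) w != [set: V]%SET]); last first.
  by apply/eq_set => w; apply/propext; exact: covering_time_gt.
apply: (measurable_finpred (collected Xs _) _ (fun S => S != [set: V]%SET)).
exact: measurable_collected.
Qed.

Lemma measurable_covering_time_lt (s : \bar R) :
  measurable [set w | (covering_time Xs w < s)%E].
Proof.
rewrite (_ : [set _ | _] = \bigcup_(t in [set t : nat | (t%:R%:E < s)%E])
    [set w | collected Xs t w = [set: V]%SET]).
  by apply: bigcup_measurable => t _; exact: measurable_collected.
apply/seteqP; split=> w /=; first by move=> /covering_time_lt[t ? ?]; exists t.
by move=> [t ? ?]; apply/covering_time_lt; exists t.
Qed.

End Collected.

(** * Tail bounds for i.i.d. coupons *)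

Section Iid.
Context {R : realType} {V : finType} {d d' : measure_display}
  {Omega : measurableType d} {Omega' : measurableType d'}
  {P : probability Omega R} {Q : probability Omega' R}
  {X : {RV P >-> coupon V}} {Xs : nat -> {RV Q >-> coupon V}}.
Context (iid : iid_copies X Xs).

Lemma prob_forall_iid (A : set (coupon V)) (p : R) t : P (X @^-1` A) = p%:E ->
  Q [set w | forall i, (i < t)%N -> A (Xs i w)] = (p ^+ t)%:E.
Proof.
(* Independence concerns finite index sets, so the first [t] indices are packed into [J]. *)
case: iid => ind eqd PA; pose J := [fset i in iota 0 t]%fset.
have -> : [set w | forall i, (i < t)%N -> A (Xs i w)] =
    \bigcap_(j in [set` J]) (Xs j @^-1` A).
  apply/seteqP; split=> w Aw i; last by move=> it; apply: Aw; rewrite /= !inE mem_iota.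
  by rewrite /= !inE mem_iota => /= /Aw.
rewrite (ind J (fun=> A)).
rewrite (eq_bigr (fun=> p%:E)) => [|j _]; last by rewrite -PA; exact: eqd.
rewrite (perm_big (iota 0 t)); last first.
  by apply: uniq_perm; rewrite ?fset_uniq ?iota_uniq// => i; rewrite !inE.
by rewrite prodEFin big_const_seq count_predT size_iota iter_mulr_1.
Qed.

Context {c : R}.
Context (hc : forall x : V, P [set w | x \in (X w : {set V})] = c%:E).
Context (hneg : pairwise_negative_correlation X).

Lemma prob_notin_coupon x : P [set w | x \notin (X w : {set V})] = (1 - c)%:E.
Proof.
rewrite EFinB -(hc x) -probability_setC; last first.
  by apply: (measurable_funPTI X (Y := [set S : coupon V | x \in (S : {set V})])).
by congr (P _); apply/seteqP; split=> w /= /negP.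
Qed.

Lemma prob_notin_collected x t :
  Q [set w | x \notin collected Xs t w] = ((1 - c) ^+ t)%:E.
Proof.
rewrite -(@prob_forall_iid [set S : coupon V | x \notin (S : {set V})]).
  by congr (Q _); apply/eq_set => w; apply/propext; exact: notin_collected.
exact: prob_notin_coupon.
Qed.

Lemma prob_notin2_collected x y t : x != y ->
  (Q [set w | (x \notin collected Xs t w) && (y \notin collected Xs t w)]
    <= (((1 - c) ^+ t) ^+ 2)%:E)%E.
Proof.
move=> xy; pose A := [set S : coupon V | x \notin (S : {set V}) /\ y \notin (S : {set V})].
have fin : P (X @^-1` A) \is a fin_num.
  by rewrite fin_num_measure//; exact: measurable_funPTI.
have := hneg _ _ xy; rewrite -/(X @^-1` A) !prob_notin_coupon -EFinM -[X in (X <= _)%E]fineK//.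
rewrite lee_fin => le.
rewrite (_ : [set _ | _] = [set w | forall i, (i < t)%N -> A (Xs i w)]).
  (* The one-coupon bound [(1 - c) ^+ 2] is raised to the power [t], after exchanging the two
     exponents. *)
  rewrite (prob_forall_iid _ _ _ (esym (fineK fin))) lee_fin exprAC expr2.
  by apply: lerXn2r; rewrite ?nnegrE ?fine_ge0// (le_trans _ le)// fine_ge0.
apply/eq_set => w; apply/propext; split=> [/andP[/notin_collected xt /notin_collected yt] i it|H].
  by split; [exact: xt|exact: yt].
by apply/andP; split; apply/notin_collected => i /H[].
Qed.


Context (c_gt0 : 0 < c) (c_lt1 : c < 1) (V_gt1 : (1 < #|V|)%N).

Let n : R := #|V|%:R.
Let L : R := ln n / - ln (1 - c).

Let q_gt0 : 0 < 1 - c. Proof. by rewrite subr_gt0. Qed.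

Let lnq_lt0 : ln (1 - c) < 0. Proof. by rewrite ln_lt0// q_gt0 ltrBlDr ltrDl. Qed.

Let n_gt1 : 1 < n. Proof. by rewrite ltr1n. Qed.

Let n_gt0 : 0 < n. Proof. exact: lt_trans n_gt1. Qed.

Let L_gt0 : 0 < L.
Proof. by rewrite divr_gt0 ?ln_gt0// oppr_gt0. Qed.

(** [L] is the real time at which a fixed element is missed with probability [1 / n]; this turns
    powers of [1 - c] into powers of [n]. *)
Let powR_L k : (1 - c) `^ (k * L) = n `^ (- k).
Proof.
rewrite /powR !gt_eqF//; congr expR; rewrite /L; field.
by rewrite lt_eqF.
Qed.

Lemma covering_time_upper_tail (eps : R) : 0 <= eps ->
  (Q [set w | (((1 + eps) * L)%:E < covering_time Xs w)%E] <=
    (n `^ (- eps) / (1 - c))%:E)%E.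
Proof.
move=> e0; have s0 : 0 <= (1 + eps) * L by rewrite mulr_ge0 ?addr_ge0// ltW.
rewrite (_ : [set _ | _] =
    [set w | collected Xs (Num.truncn ((1 + eps) * L)) w != [set: V]%SET]); last first.
  by apply/eq_set => w; apply/propext; exact: covering_time_gt.
apply: le_trans (prob_neqT_le _ _ _ _ _) _.
- exact: measurable_collected.
- by move=> x; rewrite prob_notin_collected.
(* Rounding the time down costs the factor [1 / (1 - c)]: moving it across raises the exponent to
   [truncn + 1], which exceeds [(1 + eps) * L]. *)
rewrite lee_fin -/n ler_pdivlMr// -mulrA -exprSr.
apply: (@le_trans _ _ (n * (1 - c) `^ ((1 + eps) * L))).
  rewrite ler_pM2l// -powR_mulrn ?(ltW q_gt0)//; apply: ger_powR.
    by rewrite q_gt0 gerBl ltW.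
  by rewrite ltW// truncnS_gt.
rewrite powR_L -[X in X * _]powRr1 ?(ltW n_gt0)// -powRD ?(gt_eqF n_gt0) ?implybT//.
by rewrite opprD addrA subrr add0r.
Qed.

Lemma covering_time_lower_tail (eps : R) :
  (Q [set w | (covering_time Xs w < ((1 - eps) * L)%:E)%E] <=
    (n `^ (- eps))%:E)%E.
Proof.
(* For [eps > 1] the threshold is negative and the event is empty. *)
have [s0|s0] := leP 0 ((1 - eps) * L); last first.
  rewrite (_ : [set _ | _] = set0) ?measure0 ?lee_fin ?powR_ge0//.
  apply/seteqP; split=> // w /= /covering_time_lt[t _]; rewrite lte_fin => ts.
  by have := lt_trans ts s0; rewrite ltrn0.
set m := Num.truncn ((1 - eps) * L).
apply: (@le_trans _ _ (Q [set w | collected Xs m w = [set: V]%SET])).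
  apply: le_measure; rewrite ?inE.
  - exact: measurable_covering_time_lt.
  - exact: measurable_collected.
  move=> w /= /covering_time_lt[t tV]; rewrite lte_fin => ts.
  by apply: collected_covered tV; rewrite truncn_ge_nat// ltW.
apply: le_trans (prob_eqT_le _ _ _ _ _ (prob_notin_collected^~ m) _) _.
- exact: measurable_collected.
- by rewrite mulr_gt0// exprn_gt0.
- by move=> x y xy; exact: prob_notin2_collected.
rewrite lee_fin powRN lef_pV2 ?posrE ?powR_gt0 ?mulr_gt0 ?exprn_gt0//.
apply: (@le_trans _ _ (n * (1 - c) `^ ((1 - eps) * L))).
  rewrite powR_L -[X in X * _]powRr1 ?(ltW n_gt0)// -powRD ?(gt_eqF n_gt0) ?implybT//.
  by rewrite opprB addrC subrK lexx.
(* Rounding down is harmless here: fewer coupons only raise the expected number of missed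
   elements. *)
rewrite ler_pM2l// -powR_mulrn ?(ltW q_gt0)//; apply: ger_powR.
  by rewrite q_gt0 gerBl ltW.
by rewrite truncn_le.
Qed.

Lemma covering_time_deviation (eps : R) : 0 < eps ->
  (Q [set w | (eps%:E < `|covering_time Xs w * (L^-1)%:E - 1%:E|)%E] <=
    (n `^ (- eps) * (1 + (1 - c)^-1))%:E)%E.
Proof.
move=> e0.
rewrite (_ : [set _ | _] =
    [set w | (covering_time Xs w < ((1 - eps) * L)%:E)%E] `|`
    [set w | (((1 + eps) * L)%:E < covering_time Xs w)%E]); last first.
  (* The value [+oo] belongs to the upper tail and [-oo] formally to the lower one; for finite
     values, multiply through by [L > 0]. *)
  apply/seteqP; split=> w /=; case: (covering_time Xs w) => [t||].
  - rewrite -EFinM -EFinB !lte_fin => h.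
    have [h'|h'] := ltP t ((1 - eps) * L); [by left|right].
    move: h; rewrite lter_normr => /orP[|].
      by rewrite ltrBrDl ltr_pdivlMr.
    rewrite opprB ltrBrDr -ltrBrDl ltr_pdivrMr// => h.
    by have := lt_le_trans h h'; rewrite ltxx.
  - by move=> _; right; rewrite ltry.
  - by move=> _; left; rewrite ltNyr.
  - rewrite -EFinM -EFinB !lte_fin lter_normr => -[h|h]; apply/orP.
      by right; rewrite opprB ltrBrDr -ltrBrDl ltr_pdivrMr.
    by left; rewrite ltrBrDl ltr_pdivlMr.
  - by move=> _; rewrite gt0_mulye ?lte_fin ?invr_gt0//= ltry.
  - by move=> _; rewrite gt0_mulNye ?lte_fin ?invr_gt0//= ltry.
have mg := measurable_covering_time_gt Xs ((1 + eps) * L).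
apply: le_trans (measureU2 _ _ _) _.
- exact: measurable_covering_time_lt.
- by apply: mg; rewrite mulr_ge0 ?ltW// addr_gt0.
rewrite mulrDr mulr1 EFinD; apply: leeD.
  exact: covering_time_lower_tail.
by apply: covering_time_upper_tail; rewrite ltW.
Qed.

End Iid.

(** * Passage to the limit in [n] *)

Lemma cvgn_powRN {R : realType} (e : R) : 0 < e ->
  n%:R `^ (- e) @[n --> \oo] --> (0 : R).
Proof.
move=> e0; apply/cvgrPdist_lt => r r0.
near=> n.
have n0 : 0 < n%:R :> R by near: n; exact: nbhs_infty_gtr.
rewrite sub0r normrN ger0_norm ?powR_ge0//.
(* Taking logarithms, the inequality becomes [expR (- ln r / e) < n]. *)
rewrite -[ltRHS]lnK ?posrE// /powR gt_eqF// ltr_expR mulNr ltrNl.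
rewrite mulrC -ltr_pdivrMr// -ltr_expR lnK ?posrE//.
by near: n; exact: nbhs_infty_gtr.
Unshelve. all: by end_near. Qed.

Theorem corollary3p5 (R : realType) (delta : R) (hdelta : 0 < delta)
  (V : nat -> finType) (hV : forall n, #|V n| = n)
  (d d' : nat -> measure_display)
  (Omega : forall n, measurableType (d n))
  (Omega' : forall n, measurableType (d' n))
  (P : forall n, probability (Omega n) R)
  (Q : forall n, probability (Omega' n) R)
  (X : forall n, {RV (P n) >-> coupon (V n)})
  (Xs : forall n, nat -> {RV (Q n) >-> coupon (V n)})
  (hXs : forall n, iid_copies (X n) (Xs n))
  (hbal : forall n, balanced (X n))
  (hneg : forall n, pairwise_negative_correlation (X n))
  (c : nat -> R)
  (hc : forall n (x : V n), P n [set w | x \in (X n w : {set V n})] = (c n)%:E)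
  (hc0 : forall n, 0 < c n) (hc1 : forall n, c n <= 1 - delta) :
  cvg_in_probability Q
    (fun n w =>
       (covering_time (Xs n) w * ((ln n%:R / - ln (1 - c n))^-1)%:E)%E) 1.
Proof.
move=> eps eps0.
(* As [1 - c n >= delta], the factor [1 / (1 - c n)] is bounded by [delta^-1] uniformly in [n]. *)
apply: (@squeeze_cvge _ _ _ _ (cst 0%E) _
  (fun n => (n%:R `^ (- eps) * (1 + delta^-1))%:E)).
- near=> n; rewrite measure_ge0/=.
  have c1 : c n < 1 by rewrite (le_lt_trans (hc1 n))// gtrBl.
  have := covering_time_deviation (hXs n) (hc n) (hneg n) (hc0 n) c1 _ _ eps0.
  (* The deviation bound needs [1 < n], which makes [L] positive; this holds eventually. *)
  rewrite hV => /(_ _)/le_trans -> //; first by near: n; exact: nbhs_infty_gt.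
  rewrite lee_fin ler_wpM2l ?powR_ge0// lerD2l lef_pV2 ?posrE ?subr_gt0//.
  by rewrite lerBrDr -lerBrDl.
- exact: cvg_cst.
- apply: cvg_EFin; first by near=> n.
  rewrite -[X in _ --> X](mul0r (1 + delta^-1)).
  by apply: cvgMl; exact: cvgn_powRN.
Unshelve. all: by end_near. Qed.
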